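(* Let $r \geq 2$ be an integer. If a Steiner system $S(2,r,n)$ exists, then there is a biregular bipartite graph $G$ of girth at least $6$ with $\chi_r(G) \geq n$.
   Context: A Steiner system $S(2,r,n)$ is a pair $(V,\mathcal{B})$ where $V$ is an $n$-element set and $\mathcal{B}$ is a family of $r$-element subsets of $V$ (blocks) such that every $2$-element subset of $V$ is contained in exactly one block. A bipartite graph with parts $X,Y$ is biregular if all vertices of $X$ have the same degree and all vertices of $Y$ have the same degree. The girth is the length of a shortest cycle (infinite if there is none). For a vertex $v$, $N(v)$ is its set of neighbors and $\deg(v)=|N(v)|$; for a coloring $\phi$ and a vertex set $U$, $\phi(U)=\{\phi(u):u\in U\}$. An $r$-hued coloring of a simple graph $G$ is a proper vertex coloring $\phi$ such that $|\phi(N(v))| \geq \min\{r,\deg(v)\}$ for every vertex $v$; $\chi_r(G)$ is the minimum number of colors in an $r$-hued coloring of $G$. *)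

(* Defs.v *)
From mathcomp Require Import all_boot.

Set Implicit Arguments.
Unset Strict Implicit.
Unset Printing Implicit Defensive.

(** Steiner systems S(2, r, n).  Blocks form a set rather than a multiset:
    for r >= 2 the uniqueness clause excludes repeated blocks anyway. *)
Definition steiner_system (r n : nat) (V : finType) (B : {set {set V}}) : Prop :=
  [/\ #|V| = n,
      forall b : {set V}, b \in B -> #|b| = r
    & forall p : {set V}, #|p| = 2 ->
        exists! b : {set V}, b \in B /\ p \subset b].

Record sgraph : Type := SGraph {
  vertex :> finType;
  adj : rel vertex;
  adj_sym : symmetric adj;
  adj_irrefl : irreflexive adj
}.

Definition nbh (G : sgraph) (v : G) : {set G} := [set u | adj v u].

Definition deg (G : sgraph) (v : G) : nat := #|nbh v|.

(** A part is allowed to be empty. *)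
Definition bipartition (G : sgraph) (X Y : {set G}) : Prop :=
  [/\ X :|: Y = [set: G],
      [disjoint X & Y]
    & forall u v : G, adj u v ->
        (u \in X) && (v \in Y) || (u \in Y) && (v \in X)].

Definition biregular_bipartite (G : sgraph) : Prop :=
  exists X Y : {set G},
    [/\ bipartition X Y,
        {in X &, forall u v, deg u = deg v}
      & {in Y &, forall u v, deg u = deg v}].

(** The bound [2 < k] rules out an edge traversed back and forth, which
    [ucycleb] alone would accept as a cycle of length 2. *)
Definition has_cycle (G : sgraph) (k : nat) : bool :=
  (2 < k) && [exists c : k.-tuple G, ucycleb (@adj G) c].

(** [None] stands for infinite girth; a cycle has at most [#|G|] vertices, so
    bounding the search by [#|G|] loses nothing. *)
Definition girth (G : sgraph) : option nat :=
  if [pick k : 'I_#|G|.+1 | has_cycle G k] is Some k0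
  then Some (nat_of_ord [arg min_(k < k0 | has_cycle G k) nat_of_ord k])
  else None.

Definition girth_at_least (G : sgraph) (m : nat) : Prop :=
  if girth G is Some g then m <= g else True.

Definition proper_coloring (G : sgraph) (k : nat) (phi : {ffun G -> 'I_k}) : bool :=
  [forall u, forall v, adj u v ==> (phi u != phi v)].

Definition hued_coloring (r : nat) (G : sgraph) (k : nat)
    (phi : {ffun G -> 'I_k}) : bool :=
  proper_coloring phi &&
  [forall v : G, minn r (deg v) <= #|[set phi u | u in nbh v]|].

Definition hued_colorable (r : nat) (G : sgraph) (k : nat) : bool :=
  [exists phi : {ffun G -> 'I_k}, hued_coloring r phi].

Lemma ex_hued_colorable (r : nat) (G : sgraph) : exists k, hued_colorable r G k.
Proof.
exists #|G|; apply/existsP; exists [ffun v => enum_rank v].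
apply/andP; split.
  apply/forallP => u; apply/forallP => v; apply/implyP => uv.
  rewrite !ffunE (inj_eq enum_rank_inj).
  by apply: contraTneq uv => ->; rewrite adj_irrefl.
apply/forallP => v; rewrite card_imset ?geq_minr //.
by move=> x y; rewrite !ffunE => /enum_rank_inj.
Qed.

Definition hued_chromatic_number (r : nat) (G : sgraph) : nat :=
  ex_minn (ex_hued_colorable r G).

Lemma girth_at_leastP (G : sgraph) (m : nat) :
  girth_at_least G m <-> (forall k, has_cycle G k -> m <= k).
Proof.
have bnd k : has_cycle G k -> k < #|G|.+1.
  case/andP=> _ /existsP[c /andP[_ cU]].
  by rewrite ltnS -(size_tuple c) -(card_uniqP cU) max_card.
rewrite /girth_at_least /girth; case: pickP => [k0 ck0 | noc]; last first.
  by split=> // _ k ck; have := noc (Ordinal (bnd k ck)); rewrite /= ck.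
case: arg_minnP => // i ci imin; split=> [mi k ck | H]; last exact: H.
exact: leq_trans mi (imin (Ordinal (bnd k ck)) ck).
Qed.

(* Main.v *)
(** The graph is the point-block incidence graph of the Steiner system. A
    4-cycle in it would be two blocks sharing two points. Every block has degree
    [r], so an [r]-hued coloring is injective on every block; as any two points
    lie in a common block, the [n] points get pairwise distinct colors. *)
Require Import Defs.
From mathcomp Require Import all_boot.

Set Implicit Arguments.
Unset Strict Implicit.
Unset Printing Implicit Defensive.

(** Block vertices come from the subtype of members of [B], so every [inr] vertex carries a proof
    that it is a block. *)
Definition incidence (V : finType) (B : {set {set V}}) :
    rel (V + {b : {set V} | b \in B})%type :=
  fun u v => match u, v with
  | inl x, inr b | inr b, inl x => x \in val b
  | _, _ => false
  end.

Lemma incidence_sym (V : finType) (B : {set {set V}}) :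
  symmetric (@incidence V B).
Proof. by case=> ? []. Qed.

Lemma incidence_irrefl (V : finType) (B : {set {set V}}) :
  irreflexive (@incidence V B).
Proof. by case. Qed.

Definition incidence_graph (V : finType) (B : {set {set V}}) : sgraph :=
  SGraph (@incidence_sym V B) (@incidence_irrefl V B).

(** The uniqueness axiom for [[set x; y]], recast as a boolean equation that can be rewritten under
    sums. *)
Lemma steiner_block (r n : nat) (V : finType) (B : {set {set V}}) (x y : V) :
  steiner_system r n B -> x != y ->
  exists2 b0 : {set V}, b0 \in B
    & forall b, b \in B -> (x \in b) && (y \in b) = (b == b0).
Proof.
case=> _ _ uB xy; have [|b0 [[b0B sb0] ub0]] := uB [set x; y].
  by rewrite cards2 xy.
exists b0 => // b bB; apply/idP/eqP => [/andP[xb yb] | ->].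
  by apply/esym/ub0; split=> //; rewrite subUset !sub1set xb.
by move: sb0; rewrite subUset !sub1set.
Qed.

(** Double counting of pairs [(y, b)] with [y != x] and [b] a block through [x] and [y]: each [y]
    lies in one such block, and each block through [x] has [r.-1] such points. *)
Lemma steiner_point_degree (r n : nat) (V : finType) (B : {set {set V}}) (x : V) :
  steiner_system r n B -> #|[set b in B | x \in b]| * r.-1 = n.-1.
Proof.
move=> SB; have [cV cB _] := SB.
have -> : n.-1 = \sum_(y | y != x) 1.
  by rewrite sum1_card -cV -(cardC1 x).
rewrite (eq_bigr (fun y => \sum_(b in [set b in B | x \in b] | y \in b) 1)); last first.
  move=> y; rewrite eq_sym => /(steiner_block SB)[b0 b0B b0P].
  (* The 1 counted for [y] becomes a sum over the single block [b0] through [x] and [y]. *)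
  rewrite -[LHS](big_pred1_eq addn b0 (fun=> 1)); apply: eq_bigl => b.
  rewrite inE -andbA; case: (boolP (b \in B)) => [/b0P -> //| bB].
  by apply: contraNF bB => /eqP ->.
rewrite (exchange_big_dep (mem [set b in B | x \in b])) /=; last by move=> ? ? _ /andP[].
rewrite -sum_nat_const; apply: eq_bigr => b; rewrite inE => /andP[bB xb].
rewrite -(cB b bB) (cardsD1 x) xb sum1_card /=; apply: eq_card => y.
by rewrite [RHS]unfold_in /= !inE bB.
Qed.

(** The block vertices through [x] map injectively by [inr] onto the neighborhood and by [val] onto
    the members of [B] containing [x]. *)
Lemma deg_point (V : finType) (B : {set {set V}}) (x : V) :
  deg (inl x : incidence_graph B) = #|[set b in B | x \in b]|.
Proof.
have inrI : injective (@inr V {b : {set V} | b \in B}) by move=> ? ? [].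
have -> : [set b in B | x \in b] = val @: [set b : {b | b \in B} | x \in val b].
  apply/setP => b; rewrite inE; apply/andP/imsetP => [[bB xb] | [b']].
    by exists (exist _ b bB); rewrite ?inE.
  by rewrite inE => xb ->; split=> //; apply: valP.
rewrite card_imset; last exact: val_inj.
rewrite -(card_imset _ inrI); congr #|pred_of_set _|; apply/setP => -[y|b].
  by rewrite inE; apply/esym/imsetP => -[].
by rewrite mem_imset // !inE.
Qed.

Lemma nbh_block (V : finType) (B : {set {set V}}) (b : {b : {set V} | b \in B}) :
  nbh (inr b : incidence_graph B) = inl @: val b.
Proof.
have inlI : injective (@inl V {b : {set V} | b \in B}) by move=> ? ? [].
apply/setP => -[y|b']; first by rewrite mem_imset // inE.
by rewrite inE; apply/esym/imsetP => -[].
Qed.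

Lemma deg_block (V : finType) (B : {set {set V}}) (b : {b : {set V} | b \in B}) :
  deg (inr b : incidence_graph B) = #|val b|.
Proof. by rewrite /deg nbh_block card_imset // => ? ? []. Qed.

Lemma incidence_biregular (r n : nat) (V : finType) (B : {set {set V}}) :
  2 <= r -> steiner_system r n B -> biregular_bipartite (incidence_graph B).
Proof.
move=> r2 SB; have [_ cB _] := SB.
pose X : {set incidence_graph B} := [set u | if u is inl _ then true else false].
exists X, (~: X); split.
- split; first by rewrite setUCr.
    by rewrite disjoints_subset setCK.
  by move=> [x|b] [y|b']; rewrite !inE.
- move=> [x|b] [y|b']; rewrite !inE // => _ _; apply/eqP.
  (* Both point degrees times [r.-1] equal [n.-1]; since [r >= 2], the factor cancels. *)
  have r1 : 0 < r.-1 by rewrite -ltnS prednK // ltnW.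
  by rewrite !deg_point -(eqn_pmul2r r1) !(steiner_point_degree _ SB).
- by move=> [x|b] [y|b']; rewrite !inE // => _ _; rewrite !deg_block !cB ?(valP b) ?(valP b').
Qed.

Lemma incidence_girth (r n : nat) (V : finType) (B : {set {set V}}) :
  steiner_system r n B -> girth_at_least (incidence_graph B) 6.
Proof.
move=> SB.
have no4 (x y : V) (b c : {b : {set V} | b \in B}) : x != y -> b != c ->
    x \in val b -> y \in val b -> x \in val c -> y \in val c -> False.
  move=> /(steiner_block SB)[b0 _ b0P] /eqP bc xb yb xc yc.
  have /eqP eb : val b == b0 by rewrite -b0P ?(valP b) ?xb.
  have /eqP ec : val c == b0 by rewrite -b0P ?(valP c) ?xc.
  by apply/bc/val_inj; rewrite eb ec.
apply/girth_at_leastP => k /andP[k2 /existsP[[c /= /eqP ck] /andP[cc uc]]].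
rewrite leqNgt; apply/negP => k6; move: k2 k6 cc uc; rewrite -{}ck.
(* The bounds on the size leave cycles of length 3, 4 and 5. *)
case: c => [|u1 [|u2 [|u3 [|u4 [|u5 [|]]]]]] //= _ _.
(* An odd closed walk has two cyclically consecutive vertices on the same side, which are not
   adjacent; the same argument settles length 5. *)
- by case: u1 u2 u3 => ? [] ? [] ?; rewrite /= ?andbF.
(* Only the two alternating patterns survive, starting at a point or at a block. Opposite vertices
   are distinct, so [no4] applies. *)
- case: u1 u2 u3 u4 => [x|b] [y|c] [z|d] [t|e] //=; rewrite ?andbF // !inE.
    case/and5P=> xc zc ze xe _; case/and3P=> /norP[_ /norP[xz _]] /norP[_ ce] _.
    by case: (no4 x z c e).
  case/and5P=> yb yd td tb _; case/and3P=> /norP[_ /norP[bd _]] /norP[_ yt] _.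
  by case: (no4 y t b d).
- by case: u1 u2 u3 u4 u5 => ? [] ? [] ? [] ? [] ?; rewrite /= ?andbF.
Qed.

Lemma incidence_hued (r n : nat) (V : finType) (B : {set {set V}}) :
  steiner_system r n B -> n <= hued_chromatic_number r (incidence_graph B).
Proof.
move=> SB; have [cV cB _] := SB; rewrite /hued_chromatic_number.
case: ex_minnP => k /existsP[phi /andP[_ /forallP hphi]] _.
suff inj : injective (fun x : V => phi (inl x)).
  by rewrite -cV -[leqRHS]card_ord; apply: leq_card inj.
move=> x y exy; apply/eqP/idPn => nxy; have [b bB bP] := steiner_block SB nxy.
have := bP b bB; rewrite eqxx => /andP[xb yb].
(* At the block through [x] and [y] the hued condition demands [r] colors on its [r] points, so
   [phi] is injective there. *)
have := hphi (inr (exist _ b bB)); rewrite deg_block nbh_block -imset_comp cB //= minnn.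
move=> hb; have /imset_injP injb : #|[set (phi \o inl) z | z in b]| == #|b|.
  by rewrite eqn_leq leq_imset_card cB.
by rewrite (injb _ _ xb yb exy) eqxx in nxy.
Qed.

Theorem theorem5 (r n : nat) (hr : 2 <= r) :
  (exists (V : finType) (B : {set {set V}}), @steiner_system r n V B) ->
  exists G : sgraph,
    [/\ biregular_bipartite G,
        girth_at_least G 6
      & n <= hued_chromatic_number r G].
Proof.
move=> [V [B SB]]; exists (incidence_graph B); split.
- exact: incidence_biregular hr SB.
- exact: incidence_girth SB.
- exact: incidence_hued SB.
Qed.
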